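(* Let $V$ be a complex Hilbert space. For $u \in SV_{\mathbf{C}}'$ let $U : SV \to SV'$ be defined by $$[U\phi](\psi) = u(\psi_{+}\phi_{-}) \qquad (\phi,\psi \in SV).$$ Then $u \mapsto U$ is a well-defined linear isomorphism $$SV_{\mathbf{C}}' \longrightarrow \mathrm{Hom}(SV, SV')$$ onto the complex vector space of all linear maps $SV \to SV'$.
   Context: Inner products are antilinear in the first slot and linear in the second. For a complex vector space $W$, $SW = \bigoplus_{n\ge 0} S^nW$ is the (algebraic) symmetric algebra and $SW'$ is its full antidual: the complex vector space of all antilinear functionals $SW \to \mathbf{C}$. Let $J$ denote multiplication by $i$ on $V$, viewed as a real-linear operator, and $\Omega = \mathrm{Im}\langle\cdot|\cdot\rangle$. Let $V_{\mathbf{C}} = \mathbf{C}\otimes_{\mathbf{R}} V$ be the complexification of the real vector space underlying $V$, and let $J_{\mathbf{C}}$, $\Omega_{\mathbf{C}}$ be the complex-(bi)linear extensions of $J$, $\Omega$. Then $V_{\mathbf{C}} = V_{+}\oplus V_{-}$, where $J_{\mathbf{C}} = \pm i I$ on $V_{\pm}$. For $v \in V$ put $v_{+} = \frac{1}{\sqrt2}(v - iJv) \in V_{+}$ and $v_{-} = \frac{1}{\sqrt2}(v + iJv)\in V_{-}$ (here $i$ is the scalar of $V_{\mathbf{C}}$); $v\mapsto v_+$ is a complex-linear bijection $V\to V_+$ and $v\mapsto v_-$ is an antilinear bijection $V\to V_-$. These extend to a linear algebra isomorphism $SV \to S(V_{+})\subset SV_{\mathbf{C}}$, $\psi\mapsto\psi_{+}$,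 and an antilinear multiplicative bijection $SV\to S(V_{-})\subset SV_{\mathbf{C}}$, $\phi\mapsto\phi_{-}$. The product $\psi_{+}\phi_{-}$ is taken in $SV_{\mathbf{C}} \equiv S(V_+)\otimes S(V_-)$. *)

(* Defs.v *)
From HB Require Import structures.
From mathcomp Require Import all_boot all_order all_algebra.
From mathcomp Require Import ring_quotient generic_quotient complex.
From mathcomp Require Import boolp classical_sets functions reals topology.
From mathcomp Require Import normedtype.
From mathcomp Require Import finmap.
(* The notations of monalg clash with those of mathcomp-analysis. *)
From mathcomp.multinomials Require Import -(notations) monalg.

Set Implicit Arguments.
Unset Strict Implicit.
Unset Printing Implicit Defensive.

Import GRing.Theory Num.Theory numFieldNormedType.Exports.

Local Open Scope ring_scope.
Local Open Scope quotient_scope.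

(* Antilinearity of inner in its first argument follows from the first two
   axioms; positive definiteness follows from the third. *)
HB.mixin Record isComplexHilbert (R : realType) V
    of CompleteNormedModule R[i] V := {
  inner : V -> V -> R[i];
  inner_linearr : forall u a v w,
    inner u (a *: v + w) = a * inner u v + inner u w;
  inner_conj : forall u v, inner u v = (inner v u)^*;
  inner_norm : forall v, inner v v = `|v| ^+ 2
}.

#[short(type="complexHilbertType")]
HB.structure Definition ComplexHilbert (R : realType) :=
  {V of isComplexHilbert R V & CompleteNormedModule R[i] V}.

(* {f : U -> M | f (a *: u + v) = s a *: f u + f v}, with pointwise
   operations. *)
Section SemilinearMaps.
Variables (K : comNzRingType) (s : {rmorphism K -> K}) (U M : lmodType K).

Definition semilinear_fun : {pred U -> M} :=
  fun f => `[< forall a u v, f (a *: u + v) = s a *: f u + f v >].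

Record semihom := Semihom {
  semihom_fun :> U -> M;
  semihom_funP : semihom_fun \in semilinear_fun
}.

HB.instance Definition _ := [isSub for semihom_fun].
HB.instance Definition _ := [Choice of semihom by <:].

Lemma semilinear_fun_submod : submod_closed semilinear_fun.
Proof.
split=> [|a f g /asboolP lf /asboolP lg]; apply/asboolP => b u v.
  by rewrite scaler0 addr0.
have E w : (a *: f + g) w = a *: f w + g w by [].
rewrite !E lf lg !scalerDr !scalerA [s b * a]mulrC !addrA.
by congr (_ + _); rewrite -!addrA; congr (_ + _); exact: addrC.
Qed.

HB.instance Definition _ :=
  GRing.isSubmodClosed.Build K (U -> M) semilinear_fun semilinear_fun_submod.
HB.instance Definition _ := [SubChoice_isSubLmodule of semihom by <:].

Lemma semihomP (f : semihom) a u v : f (a *: u + v) = s a *: f u + f v.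
Proof. by have /asboolP := semihom_funP f; apply. Qed.

HB.instance Definition _ (f : semihom) :=
  GRing.isLinear.Build K U M (s \; *:%R) (semihom_fun f) (semihomP f).

End SemilinearMaps.

Notation linHom U M := (semihom idfun U M).

Definition antidual (R : realType) (W : lmodType R[i]) :=
  semihom Num.conj W (R[i])^o.

Section SymmetricAlgebra.
Variables (K : fieldType) (W : lmodType K).

(* The polynomial algebra K[W] whose indeterminates are the vectors of W. *)
Local Notation freecomalg := (malg (cmonom W) K).

Definition freecomvar (w : W) : freecomalg := mkmalgU (ucm w) 1.

(* The ideal of K[W] generated by the X_(a v + w) - a X_v - X_w. *)
Inductive linear_relations : freecomalg -> Prop :=
| linear_relations0 : linear_relations 0
| linear_relationsD (p q : freecomalg) (a : K) (v w : W) :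
    linear_relations q ->
    linear_relations (p * (freecomvar (a *: v + w)
                           - (a *: freecomvar v + freecomvar w)) + q).

Definition sym_ideal : {pred freecomalg} := fun p => `[< linear_relations p >].

Lemma sym_ideal_closed : idealr_closed sym_ideal.
Proof.
split.
- exact/asboolP/linear_relations0.
- apply/asboolP => H.
  suff : mcoeff (@mone (cmonom W)) (1 : freecomalg) = 0.
    by move/eqP; rewrite mcoeff1 eqxx oner_eq0.
  elim: H => [|p q a v w _ IH]; first by rewrite raddf0.
  have e0 u : mcoeff (@mone (cmonom W)) (freecomvar u) = 0.
    by rewrite mcoeffU cm1_eq1 mulr0n.
  have [eM _] := @mcoeff1g_is_multiplicative (cmonom W) K.
  rewrite mcoeffD eM mcoeffB mcoeffD mcoeffZ IH.
  move: (freecomvar v) (freecomvar w) (freecomvar _) (e0 v) (e0 w)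
    (e0 (a *: v + w)) => x y z -> -> ->.
  by rewrite mulr0 !addr0 subr0 mulr0.
- move=> a u v /asboolP Hu /asboolP Hv; apply/asboolP.
  elim: Hu => [|p q b x y _ IH]; first by rewrite mulr0 add0r.
  by rewrite mulrDr mulrA -addrA; apply: linear_relationsD.
Qed.

HB.instance Definition _ := isIdealr.Build freecomalg sym_ideal sym_ideal_closed.

Definition symalg := {ideal_quot sym_ideal}.
HB.instance Definition _ := GRing.ComNzRing.on symalg.


Definition sym_pi (p : freecomalg) : symalg := \pi_symalg p.

Lemma sym_pi_zmod : zmod_morphism sym_pi.
Proof. exact: pi_is_zmod_morphism. Qed.

Lemma sym_pi_monoid : monoid_morphism sym_pi.
Proof. exact: pi_is_monoid_morphism. Qed.

HB.instance Definition _ :=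
  GRing.isZmodMorphism.Build freecomalg symalg sym_pi sym_pi_zmod.
HB.instance Definition _ :=
  GRing.isMonoidMorphism.Build freecomalg symalg sym_pi sym_pi_monoid.

Definition sym_scale (a : K) (x : symalg) : symalg := sym_pi a%:A * x.

Lemma sym_scaleA a b x : sym_scale a (sym_scale b x) = sym_scale (a * b) x.
Proof.
have E : (a * b)%:A = a%:A * b%:A :> freecomalg.
  exact: (rmorphM (in_alg freecomalg)).
by rewrite /sym_scale E (rmorphM sym_pi); exact: mulrA.
Qed.

Lemma sym_scale1 : left_id 1 sym_scale.
Proof. by move=> x; rewrite /sym_scale scale1r (rmorph1 sym_pi) mul1r. Qed.

Lemma sym_scaleDr : right_distributive sym_scale +%R.
Proof. by move=> a x y; rewrite /sym_scale mulrDr. Qed.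

Lemma sym_scaleDl x : {morph sym_scale^~ x : a b / a + b}.
Proof. by move=> a b; rewrite /sym_scale scalerDl (rmorphD sym_pi) mulrDl. Qed.

HB.instance Definition _ := GRing.Zmodule_isLmodule.Build K symalg
  sym_scaleA sym_scale1 sym_scaleDr sym_scaleDl.

Lemma sym_scaleAl (a : K) (x y : symalg) : a *: (x * y) = (a *: x) * y.
Proof. exact: mulrA. Qed.

HB.instance Definition _ := GRing.Lmodule_isLalgebra.Build K symalg sym_scaleAl.
HB.instance Definition _ := GRing.Lalgebra_isComAlgebra.Build K symalg.

Definition sym_gen (w : W) : symalg := sym_pi (freecomvar w).

Lemma sym_piZ (a : K) (p : freecomalg) : sym_pi (a *: p) = a *: sym_pi p.
Proof. by rewrite -{1}[p]mul1r scalerAl rmorphM. Qed.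

Lemma sym_gen_linear : linear sym_gen.
Proof.
move=> a v w; rewrite /sym_gen -sym_piZ -rmorphD; apply/eqP.
rewrite -Quotient.idealrBE; apply/asboolP.
by rewrite -[X in linear_relations X]addr0 -[X in X + 0]mul1r;
  apply: linear_relationsD; exact: linear_relations0.
Qed.

HB.instance Definition _ :=
  GRing.isLinear.Build K W symalg *:%R sym_gen sym_gen_linear.

End SymmetricAlgebra.

Arguments sym_ideal {K W} p.
Arguments sym_pi {K W} p.

(* The ring morphism S W -> A equal to s on scalars and to f on W; meaningful
   when f is additive and s-homogeneous. *)
Section Lift.
Variables (K : fieldType) (W : lmodType K) (A : comNzRingType).
Variables (s : {rmorphism K -> A}) (f : W -> A).

Definition monom_eval (m : cmonom W) : A := \prod_(w <- finsupp m) f w ^+ m w.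

Definition sym_lift (x : symalg W) : A := mmap s monom_eval (repr x).

Lemma monom_evalE (d : {fset W}) (m : cmonom W) :
  fsubset (finsupp m) d -> monom_eval m = \prod_(w <- d) f w ^+ m w.
Proof.
move=> md; rewrite /monom_eval (big_fset_incl _ md) // => w _.
by rewrite -cmE_neq0 negbK => /eqP ->.
Qed.

Lemma monom_eval_mmorphism : mmorphism monom_eval.
Proof.
split=> [m n|]; last by rewrite /monom_eval mdom1 big_seq_fset0.
rewrite (@monom_evalE (fsetU (finsupp m) (finsupp n)) m) ?fsubsetUl //.
rewrite (@monom_evalE (fsetU (finsupp m) (finsupp n)) n) ?fsubsetUr //.
rewrite /monom_eval mdomD -big_split /=.
by apply: eq_bigr => w _; rewrite cmM exprD.
Qed.

HB.instance Definition _ :=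
  isMultiplicative.Build (cmonom W) A monom_eval monom_eval_mmorphism.

Lemma monom_evalU w : monom_eval (ucm w) = f w.
Proof. by rewrite /monom_eval mdomU big_seq_fset1 cmUU expr1. Qed.

Hypothesis fL : forall a v w, f (a *: v + w) = s a * f v + f w.

Lemma sym_lift_pi p : sym_lift (sym_pi p) = mmap s monom_eval p.
Proof.
pose F : {rmorphism malg (cmonom W) K -> A} := mmap s monom_eval.
have Fvar w : F (freecomvar w) = f w.
  by rewrite /F /= mmapU monom_evalU /= rmorph1 mul1r.
have F0 q : linear_relations q -> F q = 0.
  elim=> [|{}q r a v w _ IH]; first exact: rmorph0.
  rewrite rmorphD rmorphM rmorphB rmorphD IH addr0.
  rewrite [F (a *: _)]mmapZ -[mmap _ _ _]/(F _).
  move: (freecomvar v) (freecomvar w) (freecomvar _) (Fvar v) (Fvar w)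
    (Fvar (a *: v + w)) => x y z -> -> ->.
  by rewrite fL subrr mulr0.
apply/eqP; rewrite -subr_eq0 -[mmap _ _ p]/(F p) -[sym_lift _]/(F _) -rmorphB.
apply/eqP/F0.
suff : repr (sym_pi p) - p \in sym_ideal by move/asboolP.
by rewrite Quotient.idealrBE reprK.
Qed.

Lemma sym_lift_zmod : zmod_morphism sym_lift.
Proof.
move=> x y; rewrite -[x]reprK -[y]reprK -!/(sym_pi _) -(rmorphB sym_pi).
by rewrite !sym_lift_pi; exact: rmorphB.
Qed.

Lemma sym_lift_monoid : monoid_morphism sym_lift.
Proof.
split=> [|x y]; first by rewrite -(rmorph1 sym_pi) sym_lift_pi; exact: rmorph1.
rewrite -[x]reprK -[y]reprK -!/(sym_pi _) -(rmorphM sym_pi).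
by rewrite !sym_lift_pi; exact: rmorphM.
Qed.

Lemma sym_liftZ a x : sym_lift (a *: x) = s a * sym_lift x.
Proof.
rewrite -[x]reprK -!/(sym_pi _) -sym_piZ !sym_lift_pi; exact: mmapZ.
Qed.

Lemma sym_lift_gen w : sym_lift (sym_gen w) = f w.
Proof. by rewrite sym_lift_pi mmapU monom_evalU /= rmorph1 mul1r. Qed.

End Lift.

Lemma sym_lift_unique (K : fieldType) (W : lmodType K) (A : comNzRingType)
    (g h : {rmorphism symalg W -> A}) :
  (forall a : K, g a%:A = h a%:A) ->
  (forall w, g (sym_gen w) = h (sym_gen w)) -> g =1 h.
Proof.
move=> gh0 gh1 x; rewrite -[x]reprK -/(sym_pi _); move: (repr x) => {x} p.
have UM (k m : cmonom W) : mkmalgU (mmul k m) 1 = mkmalgU k 1 * mkmalgU m 1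
    :> malg (cmonom W) K.
  by rewrite malgM_def fgmulUU mulr1.
have ghU (k : cmonom W) : g (sym_pi (mkmalgU k 1)) = h (sym_pi (mkmalgU k 1)).
  have [n] := ubnP (mdeg k); elim: n k => // n IH k.
  have [-> _|] := eqVneq k mone.
    by rewrite -[mkmalgU _ _]/(1 : malg (cmonom W) K) (rmorph1 sym_pi) !rmorph1.
  have [/eqP|/fset0Pn [w wk]] := eqVneq (finsupp k) fset0.
    move/eqP => k0; have -> : k = mone by apply: mdeg_eq0I; rewrite mdegE k0 big_seq_fset0.
    by rewrite eqxx.
  have -> : k = mmul (ucm w) (divcm k (ucm w)).
    apply/eqP/cmP => i; rewrite cmM divcmE cmU subnKC //.
    by case: eqP => // <-; rewrite lt0n cmE_neq0.
  rewrite mdegM mdegU => _ H; have e2 := IH _ H.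
  have e1 : g (sym_pi (mkmalgU (ucm w) 1)) = h (sym_pi (mkmalgU (ucm w) 1)).
    exact: gh1.
  rewrite (UM (ucm w) _).
  move: (mkmalgU (ucm w) 1) (mkmalgU (divcm k _) 1) e1 e2 => X Y e1 e2.
  by rewrite (rmorphM sym_pi) (rmorphM g) (rmorphM h) e1 e2.
rewrite (monalgE p) (rmorph_sum sym_pi) !rmorph_sum /=.
apply: eq_bigr => k _.
have -> : mkmalgU k (mcoeff k p) = (mcoeff k p) *: mkmalgU k 1
    :> malg (cmonom W) K.
  move: (mcoeff k p) => c; apply/malgP => m.
  apply: etrans (mcoeffU k c m) _; apply/esym.
  apply: etrans (mcoeffZ c _ m) _.
  apply: etrans (congr1 ( *%R c) (mcoeffU k 1 m)) _.
  by rewrite mulrnAr mulr1.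
move: (mkmalgU k 1) (ghU k) => X eX.
by rewrite sym_piZ -mulr_algl (rmorphM g) (rmorphM h) gh0 eX.
Qed.

Section Realification.
Variables (R : realType) (V : lmodType R[i]).

Definition realification : Type := V.
HB.instance Definition _ := GRing.Zmodule.copy realification V.

Definition real_scale (a : R) (v : realification) : realification :=
  (a%:C)%C *: (v : V).

Lemma real_scaleA a b v : real_scale a (real_scale b v) = real_scale (a * b) v.
Proof. by rewrite /real_scale scalerA -rmorphM. Qed.

Lemma real_scale1 : left_id 1 real_scale.
Proof. exact: scale1r. Qed.

Lemma real_scaleDr : right_distributive real_scale +%R.
Proof. by move=> a u v; exact: scalerDr. Qed.

Lemma real_scaleDl v : {morph real_scale^~ v : a b / a + b}.
Proof. by move=> a b; rewrite /real_scale rmorphD; exact: scalerDl. Qed.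

HB.instance Definition _ := GRing.Zmodule_isLmodule.Build R realification
  real_scaleA real_scale1 real_scaleDr real_scaleDl.

Definition Jop (v : realification) : realification := 'i *: (v : V).

Lemma Jop_linear : linear Jop.
Proof.
move=> a u v; rewrite /Jop [LHS]scalerDr; congr (_ + _).
by rewrite [LHS]scalerA mulrC -[LHS]scalerA.
Qed.

End Realification.

(* The complexification C (x)_R E, with (x, y) standing for
   1 (x) x + i (x) y. *)
Section Complexification.
Variables (R : realType) (E : lmodType R).

Definition complexification : Type := (E * E)%type.
HB.instance Definition _ := GRing.Zmodule.copy complexification (E * E)%type.

Definition cplx_scale (a : R[i]) (e : complexification) : complexification :=
  (complex.Re a *: e.1 - complex.Im a *: e.2,
   complex.Re a *: e.2 + complex.Im a *: e.1).

Lemma cplx_scaleA a b e : cplx_scale a (cplx_scale b e) = cplx_scale (a * b) e.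
Proof.
case: a b e => [a1 a2] [b1 b2] [x y]; rewrite /cplx_scale /=; congr (_, _);
  rewrite !(scalerDr, scalerN, scalerA, scalerBl, scalerDl).
- by rewrite !opprD -!addrA; congr (_ + _); rewrite addrA; exact: addrC.
- by rewrite -!addrA; congr (_ + _); rewrite addrA; exact: addrC.
Qed.

Lemma cplx_scale1 : left_id 1 cplx_scale.
Proof.
by case=> x y; rewrite /cplx_scale /= !scale1r !scale0r subr0 addr0.
Qed.

Lemma cplx_scaleDr : right_distributive cplx_scale +%R.
Proof.
move=> a [x y] [z t]; rewrite /cplx_scale /=; congr (_, _);
  by rewrite !scalerDr ?opprD addrACA.
Qed.

Lemma cplx_scaleDl e : {morph cplx_scale^~ e : a b / a + b}.
Proof.
move: e => [x y] [a1 a2] [b1 b2]; rewrite /cplx_scale /=; congr (_, _);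
  by rewrite !scalerDl ?opprD addrACA.
Qed.

HB.instance Definition _ := GRing.Zmodule_isLmodule.Build R[i] complexification
  cplx_scaleA cplx_scale1 cplx_scaleDr cplx_scaleDl.

Definition cplx_in (x : E) : complexification := (x, 0).

Lemma cplx_inE x y : (x, y) = cplx_in x + 'i *: cplx_in y :> complexification.
Proof.
rewrite -complexiE; congr (_, _); rewrite /= ?scaler0 ?scale0r ?scale1r.
  by rewrite subr0 addr0.
by rewrite !add0r.
Qed.

End Complexification.

Lemma complexification_universal (R : realType) (E : lmodType R)
    (M : lmodType R[i]) (f : {linear E -> realification M}) :
  exists2 g : {linear complexification E -> M},
    (forall x, g (cplx_in x) = f x) &
    forall h : {linear complexification E -> M},
      (forall x, h (cplx_in x) = f x) -> h =1 g.
Proof.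
pose g (e : complexification E) : M := f e.1 + 'i *: (f e.2 : M).
have gL : linear g.
  have fZ (r : R) z : f (r *: z) = (r%:C)%C *: (f z : M) :> M.
    exact: (linearZ_LR f).
  have fD z t : f (z + t) = (f z : M) + f t :> M by exact: raddfD.
  have fN z : f (- z) = - (f z : M) :> M by exact: raddfN.
  move=> a [x y] [x' y'].
  rewrite /g /= !fD fN !fZ [in RHS](complexE a) complexiE.
  move: (f x : M) (f y : M) (f x' : M) (f y' : M) => A B A' B'.
  move: ((complex.Re a)%:C)%C ((complex.Im a)%:C)%C => r m.
  rewrite [X in _ + X = _]scalerDr addrACA; congr (_ + _).
  rewrite !scalerDl !scalerDr !scalerA [r * 'i]mulrC.
  have -> : 'i * m * 'i = - m by rewrite mulrAC -expr2 sqrCi mulN1r.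
  by rewrite scaleNr -!addrA; congr (_ + _); rewrite addrC -addrA.
pose gM := GRing.isLinear.Build R[i] (complexification E) M *:%R g gL.
pose gl : {linear complexification E -> M} := HB.pack g gM.
exists gl.
  by move=> x; rewrite /= /g /= linear0 [_ *: _]scaler0 addr0.
move=> h hf [x y]; rewrite {1}cplx_inE linearD linearZ /= !hf.
by [].
Qed.

Section PlusMinus.
Variables (R : realType) (V : lmodType R[i]).

Local Notation VC := (complexification (realification V)).

Definition vec_plus (v : V) : VC :=
  (sqrtC 2)^-1 *: (cplx_in (v : realification V) - 'i *: cplx_in (Jop v)).

Definition vec_minus (v : V) : VC :=
  (sqrtC 2)^-1 *: (cplx_in (v : realification V) + 'i *: cplx_in (Jop v)).

Lemma vec_plusE (v : V) : vec_plus v = (sqrtC 2)^-1 *: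
    ((v : realification V, - Jop v) : VC).
Proof.
rewrite [(_, _)]cplx_inE /vec_plus; congr (_ *: (_ + _)).
by rewrite -scalerN; congr (_ *: _); congr (_, _); exact: oppr0.
Qed.

Lemma vec_minusE (v : V) : vec_minus v = (sqrtC 2)^-1 *:
    ((v : realification V, Jop v) : VC).
Proof. by rewrite [(_, _)]cplx_inE. Qed.

Lemma real_rect (a : R[i]) (v : V) :
  a *: v = complex.Re a *: (v : realification V) + complex.Im a *: Jop v.
Proof. by rewrite {1}(complexE a) scalerDl [_ * _]mulrC -scalerA. Qed.

Lemma Jop_rect (a : R[i]) (v : V) :
  Jop (a *: v) = complex.Re a *: Jop v - complex.Im a *: (v : realification V).
Proof.
rewrite /Jop scalerA mulrC -scalerA [LHS]real_rect; congr (_ + _).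
by rewrite /Jop -scalerN scalerA -expr2 sqrCi scaleN1r.
Qed.

Lemma JopD (u v : V) : Jop (u + v) = Jop u + Jop v.
Proof. exact: (scalerDr ('i : R[i]) u v). Qed.

Lemma vec_plus_linear : linear vec_plus.
Proof.
move=> a u v; rewrite !vec_plusE scalerA [a * _]mulrC -scalerA -scalerDr.
congr (_ *: _); congr (_, _) => /=.
  by rewrite scalerN opprK -real_rect.
by rewrite JopD Jop_rect scalerN !opprD opprK.
Qed.

Lemma vec_minus_antilinear a u v :
  vec_minus (a *: u + v) = a^* *: vec_minus u + vec_minus v.
Proof.
rewrite !vec_minusE scalerA [_^* * _]mulrC -scalerA -scalerDr.
congr (_ *: _); case: a => r m; congr (_, _) => /=.
  by rewrite scaleNr opprK [_ *: u]real_rect.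
by rewrite JopD Jop_rect scaleNr.
Qed.

HB.instance Definition _ :=
  GRing.isLinear.Build R[i] V VC *:%R vec_plus vec_plus_linear.
HB.instance Definition _ :=
  GRing.isLinear.Build R[i] V VC (Num.conj \; *:%R) vec_minus
    vec_minus_antilinear.

Definition sym_plus : symalg V -> symalg VC :=
  sym_lift (in_alg (symalg VC)) (fun v => sym_gen (vec_plus v)).

Definition sym_minus : symalg V -> symalg VC :=
  sym_lift (in_alg (symalg VC) \o Num.conj) (fun v => sym_gen (vec_minus v)).

Lemma gen_plusL (a : R[i]) (u v : V) :
  sym_gen (vec_plus (a *: u + v)) =
  in_alg (symalg VC) a * sym_gen (vec_plus u) + sym_gen (vec_plus v).
Proof. by rewrite !linearP /= mulr_algl. Qed.

Lemma gen_minusL (a : R[i]) (u v : V) :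
  sym_gen (vec_minus (a *: u + v)) =
  (in_alg (symalg VC) \o Num.conj) a * sym_gen (vec_minus u) +
  sym_gen (vec_minus v).
Proof. by rewrite vec_minus_antilinear linearP /= mulr_algl. Qed.

Lemma sym_plus_gen v : sym_plus (sym_gen v) = sym_gen (vec_plus v).
Proof. exact: (sym_lift_gen gen_plusL). Qed.

Lemma sym_minus_gen v : sym_minus (sym_gen v) = sym_gen (vec_minus v).
Proof. exact: (sym_lift_gen gen_minusL). Qed.

Lemma sym_plusZ a x : sym_plus (a *: x) = a *: sym_plus x.
Proof. by rewrite -[RHS]mulr_algl; exact: (sym_liftZ gen_plusL). Qed.

Lemma sym_minusZ a x : sym_minus (a *: x) = a^* *: sym_minus x.
Proof. by rewrite -[RHS]mulr_algl; exact: (sym_liftZ gen_minusL). Qed.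

HB.instance Definition _ := GRing.isZmodMorphism.Build (symalg V) (symalg VC)
  sym_plus (sym_lift_zmod gen_plusL).
HB.instance Definition _ := GRing.isMonoidMorphism.Build (symalg V) (symalg VC)
  sym_plus (sym_lift_monoid gen_plusL).
HB.instance Definition _ := GRing.isScalable.Build R[i] (symalg V) (symalg VC)
  *:%R sym_plus sym_plusZ.

HB.instance Definition _ := GRing.isZmodMorphism.Build (symalg V) (symalg VC)
  sym_minus (sym_lift_zmod gen_minusL).
HB.instance Definition _ := GRing.isMonoidMorphism.Build (symalg V) (symalg VC)
  sym_minus (sym_lift_monoid gen_minusL).
HB.instance Definition _ := GRing.isScalable.Build R[i] (symalg V) (symalg VC)
  (Num.conj \; *:%R) sym_minus sym_minusZ.

End PlusMinus.

(* Main.v *)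
From HB Require Import structures.
Require Import Defs.
From mathcomp Require Import all_boot all_order all_algebra complex reals.
From mathcomp Require Import generic_quotient ring_quotient boolp finmap.
From mathcomp.multinomials Require Import -(notations) monalg.

(* Write w_+ and w_- for the vectors of V with w = (w_+)_+ + (w_-)_- in V_C. The
   operators F |-> ((phi, psi) |-> F (w_- phi) psi + F phi (w_+ psi)) on
   Hom(SV, SV') commute and depend antilinearly on w, hence they make
   Hom(SV, SV') a module over S V_C (up to conjugating the scalars), on which
   psi_+ phi_- acts by F |-> F (phi * _) (psi * _). If U is the operator of u,
   then x U is the operator of u (x * _). Hence F |-> (x |-> (x F) 1 1) is
   inverse to u |-> U: no basis and no tensor product of algebras is needed. *)

Set Implicit Arguments.
Unset Strict Implicit.
Unset Printing Implicit Defensive.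

Import GRing.Theory Num.Theory.

Local Open Scope ring_scope.

Lemma perm_foldr (T : eqType) (S : Type) (f : T -> S -> S) (z : S)
    (s t : seq T) :
  left_commutative f -> perm_eq s t -> foldr f z s = foldr f z t.
Proof.
move=> fC; move: s t; apply: catCA_perm_subst => s1 s2 s3.
rewrite !foldr_cat; elim: s1 => //= x s1 ->.
by elim: s2 => //= y s2 <-.
Qed.

Section CommutativeMonomials.
Variable I : choiceType.

Lemma cmonom_ind (Q : cmonom I -> Prop) :
  Q mone -> (forall i m, Q m -> Q (mmul (ucm i) m)) -> forall m, Q m.
Proof.
move=> Q1 QM m; have [n] := ubnP (mdeg m); elim: n m => // n IH m.
have [m0 _|/fset0Pn [i im]] := eqVneq (finsupp m) fset0.
  have -> : m = mone by apply: mdeg_eq0I; rewrite mdegE m0 big_seq_fset0.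
  exact: Q1.
have -> : m = mmul (ucm i) (divcm m (ucm i)).
  apply/eqP/cmP => j; rewrite cmM divcmE cmU subnKC //.
  by case: eqP => // <-; rewrite lt0n cmE_neq0.
by rewrite mdegM mdegU => /IH /QM.
Qed.

Definition cmonom_seq (m : cmonom I) : seq I :=
  flatten [seq nseq (m i) i | i <- finsupp m].

Lemma count_cmonom_seq (m : cmonom I) i : count_mem i (cmonom_seq m) = m i.
Proof.
rewrite count_flatten sumnE !big_map.
under eq_bigr do rewrite count_nseq /= mulnbl.
have [im|/fsfun_dflt m0] := boolP (i \in finsupp m).
  by rewrite (bigD1_seq i) ?fset_uniq //= eqxx big1 ?addn0 // => j /negPf ->.
by rewrite m0 big1 // => j _; case: eqP => // ->.
Qed.

Lemma perm_cmonom_seqU i (m : cmonom I) :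
  perm_eq (cmonom_seq (mmul (ucm i) m)) (i :: cmonom_seq m).
Proof. by apply/allP => j _ /=; rewrite !count_cmonom_seq cmM cmU. Qed.

End CommutativeMonomials.

Lemma malg_ind (I : choiceType) (G : zmodType) (Q : malg I G -> Prop) :
  Q 0 -> (forall g h, Q g -> Q h -> Q (g + h)) ->
  (forall k c, Q (mkmalgU k c)) -> forall g, Q g.
Proof.
by move=> Q0 QD QU g; rewrite (monalgE g); apply: (big_ind Q) => // k _.
Qed.

Lemma malgUM (I : monomType) (A : nzRingType) (k l : I) (c d : A) :
  mkmalgU k c * mkmalgU l d = mkmalgU (mmul k l) (c * d).
Proof. by rewrite malgM_def fgmulUU. Qed.

Lemma malgZU (I : choiceType) (A : nzRingType) (k : I) (c d : A) :
  c *: mkmalgU k d = mkmalgU k (c * d).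
Proof.
apply/malgP => l; apply: etrans (mcoeffZ c _ l) _.
by rewrite !mcoeffU mulrnAr.
Qed.

Section SemilinearExtension.
Variables (I : choiceType) (K : comNzRingType) (N : lmodType K).
Variables (s : {rmorphism K -> K}) (h : I -> N).

Definition malg_ext (g : malg I K) : N :=
  \sum_(k <- msupp g) s (mcoeff k g) *: h k.

Lemma malg_extEw (d : {fset I}) (g : malg I K) : fsubset (msupp g) d ->
  malg_ext g = \sum_(k <- d) s (mcoeff k g) *: h k.
Proof.
move=> gd; rewrite /malg_ext (big_fset_incl _ gd) // => k _.
by move/mcoeff_outdom => ->; rewrite rmorph0 scale0r.
Qed.

Lemma malg_ext_semilinear a g g' :
  malg_ext (a *: g + g') = s a *: malg_ext g + malg_ext g'.
Proof.
pose d := fsetU (msupp g) (msupp g').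
have agd : fsubset (msupp (a *: g + g')) d.
  by apply: fsubset_trans (msuppD_le _ _) (fsetSU _ (msuppZ_le _ _)).
rewrite (malg_extEw agd).
rewrite (malg_extEw (fsubsetUl (msupp g) (msupp g'))).
rewrite (malg_extEw (fsubsetUr (msupp g) (msupp g'))).
rewrite scaler_sumr -big_split /=; apply: eq_bigr => k _.
by rewrite mcoeffD mcoeffZ rmorphD rmorphM scalerDl scalerA.
Qed.

HB.instance Definition _ :=
  GRing.isLinear.Build K (malg I K) N (s \; *:%R) malg_ext malg_ext_semilinear.

Lemma malg_extU k c : malg_ext (mkmalgU k c) = s c *: h k.
Proof. by rewrite (malg_extEw msuppU_le) big_seq_fset1 mcoeffUU. Qed.

End SemilinearExtension.

Lemma sym_ind (K : fieldType) (W : lmodType K) (Q : symalg W -> Prop) :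
  Q 1 -> (forall a x y, Q x -> Q y -> Q (a *: x + y)) ->
  (forall w x, Q x -> Q (sym_gen w * x)) -> forall x, Q x.
Proof.
move=> Q1 QP QM x; rewrite -[x]reprK -/(sym_pi _).
have Q0 : Q 0 by rewrite -(addNr 1) -scaleN1r; apply: QP.
elim/malg_ind: (repr x) => [|g h Qg Qh|k c].
- by rewrite (rmorph0 sym_pi).
- by rewrite (rmorphD sym_pi) -[X in X + _]scale1r; apply: QP.
rewrite -[c]mulr1 -malgZU sym_piZ -[c *: _]addr0; apply: QP => //.
elim/cmonom_ind: k => [|w m IH].
  by rewrite -[mkmalgU _ _]/(1 : malg (cmonom W) K) (rmorph1 sym_pi).
by rewrite -[1]mulr1 -malgUM (rmorphM sym_pi); apply: QM.
Qed.

(* A module over S W amounts to a vector space with commuting operators r w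
   that depend linearly on w; the dependence may as well be s-semilinear. *)
Section SymmetricAlgebraAction.
Variables (K : fieldType) (W N : lmodType K) (s : {rmorphism K -> K}).
Variable r : W -> {linear N -> N}.
Hypothesis r_comm : forall v w n, r v (r w n) = r w (r v n).
Hypothesis r_semilinear :
  forall a v w n, r (a *: v + w) n = s a *: r v n + r w n.

Definition monom_act (n : N) (m : cmonom W) : N :=
  foldr (fun w => r w : N -> N) n (cmonom_seq m).

Lemma monom_act1 n : monom_act n mone = n.
Proof. by rewrite /monom_act /cmonom_seq mdom1. Qed.

Lemma monom_act_varM n w m :
  monom_act n (mmul (ucm w) m) = r w (monom_act n m).
Proof. exact: (perm_foldr n r_comm (perm_cmonom_seqU w m)). Qed.

Definition poly_act (n : N) : malg (cmonom W) K -> N :=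
  malg_ext s (monom_act n).

HB.instance Definition _ (n : N) := GRing.Linear.on (poly_act n).

Lemma poly_actU n m c : poly_act n (mkmalgU m c) = s c *: monom_act n m.
Proof. exact: malg_extU. Qed.

Lemma poly_act_semilinear n a p q :
  poly_act n (a *: p + q) = s a *: poly_act n p + poly_act n q.
Proof. exact: linearP. Qed.

Lemma poly_actD n : {morph poly_act n : p q / p + q}.
Proof. exact: raddfD. Qed.

Lemma poly_act1 n : poly_act n 1 = n.
Proof. by rewrite [LHS]poly_actU rmorph1 scale1r monom_act1. Qed.

Lemma poly_act_varM n w p :
  poly_act n (freecomvar w * p) = r w (poly_act n p).
Proof.
elim/malg_ind: p => [|g h IHg IHh|m c].
- by rewrite mulr0 !raddf0.
- by rewrite mulrDr poly_actD [in RHS]poly_actD [RHS]raddfD; congr (_ + _).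
rewrite [freecomvar w * _]malgUM mul1r [LHS]poly_actU [in RHS]poly_actU.
by rewrite monom_act_varM linearZ.
Qed.

Lemma poly_act_relation n p : linear_relations p -> poly_act n p = 0.
Proof.
elim=> [|q {}p a v w _ IH]; first exact: raddf0.
rewrite poly_actD IH addr0 mulrC mulrBl mulrDl -scalerAl.
rewrite raddfB; apply/eqP; rewrite subr_eq0; apply/eqP.
rewrite [LHS]poly_act_varM r_semilinear [RHS]poly_act_semilinear.
by congr (_ *: _ + _); rewrite poly_act_varM.
Qed.

Definition sym_act (x : symalg W) (n : N) : N := poly_act n (repr x).

Lemma sym_act_pi p n : sym_act (sym_pi p) n = poly_act n p.
Proof.
apply/eqP; rewrite -subr_eq0 -raddfB; apply/eqP/poly_act_relation.
suff : repr (sym_pi p) - p \in sym_ideal by move/asboolP.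
by rewrite Quotient.idealrBE reprK.
Qed.

Lemma sym_act_semilinear a x y n :
  sym_act (a *: x + y) n = s a *: sym_act x n + sym_act y n.
Proof.
rewrite -[x]reprK -[y]reprK -!/(sym_pi _) -sym_piZ -(rmorphD sym_pi).
by rewrite !sym_act_pi poly_act_semilinear.
Qed.

Lemma sym_act1 n : sym_act 1 n = n.
Proof. by rewrite -(rmorph1 sym_pi) sym_act_pi poly_act1. Qed.

Lemma sym_act_genM w x n : sym_act (sym_gen w * x) n = r w (sym_act x n).
Proof.
rewrite -[x]reprK -!/(sym_pi _) -(rmorphM sym_pi) !sym_act_pi.
exact: poly_act_varM.
Qed.

Lemma sym_actM x y n : sym_act (x * y) n = sym_act x (sym_act y n).
Proof.
elim/sym_ind: x => [|a x x' IHx IHx'|w x IH].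
- by rewrite mul1r sym_act1.
- by rewrite mulrDl -scalerAl !sym_act_semilinear IHx IHx'.
by rewrite -mulrA !sym_act_genM IH.
Qed.

End SymmetricAlgebraAction.

Section SesquilinearForms.
Variables (K : comNzRingType) (s : {rmorphism K -> K}).
Variables (B A M : lmodType K).

Local Notation forms := (linHom B (semihom s A M)).

Lemma form_linearPl (F : forms) k b b' a :
  F (k *: b + b') a = k *: F b a + F b' a.
Proof. by rewrite semihomP. Qed.

Lemma form_semilinearPr (F : forms) k b a a' :
  F b (k *: a + a') = s k *: F b a + F b a'.
Proof. exact: semihomP. Qed.

Lemma form_scaleDE (F G : forms) k b a :
  (k *: F + G) b a = k *: F b a + G b a.
Proof. by []. Qed.

Lemma form_ext (F G : forms) : (forall b a, F b a = G b a) -> F = G.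
Proof.
by move=> FG; apply/val_inj/funext => b; apply/val_inj/funext => a; exact: FG.
Qed.

Section MakeForm.
Variable f : B -> A -> M.
Hypothesis f_linearl :
  forall k b b' a, f (k *: b + b') a = k *: f b a + f b' a.
Hypothesis f_semilinearr :
  forall k b a a', f b (k *: a + a') = s k *: f b a + f b a'.

Let right_semihom (b : B) : semihom s A M :=
  Semihom (introT (asboolP _) (f_semilinearr^~ b)).

Let right_semihom_linear : right_semihom \in @semilinear_fun K idfun _ _.
Proof.
by apply/asboolP => k b b'; apply/val_inj/funext => a; exact: f_linearl.
Qed.

Definition mkform : forms := Semihom right_semihom_linear.

End MakeForm.
End SesquilinearForms.

(* Stated for abstract algebras because rewriting products in symalg itself
   unfolds the quotient. *)
Section ProductForms.
Variables (K : comNzRingType) (s : {rmorphism K -> K}).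
Variables (A B C : comAlgType K) (M : lmodType K).
Variables (i : {lrmorphism A -> C}) (j : {rmorphism B -> C}).
Hypothesis s_involutive : involutive s.
Hypothesis j_scale : forall k b, j (k *: b) = s k *: j b.

Lemma semihom_mulPl (u : semihom s C M) k x y z :
  u ((k *: x + y) * z) = s k *: u (x * z) + u (y * z).
Proof. by rewrite mulrDl -scalerAl semihomP. Qed.

Lemma product_form_linearl (u : semihom s C M) k b b' a :
  u (i a * j (k *: b + b')) = k *: u (i a * j b) + u (i a * j b').
Proof. by rewrite rmorphD j_scale mulrDr -scalerAr semihomP s_involutive. Qed.

Lemma product_form_semilinearr (u : semihom s C M) k b a a' :
  u (i (k *: a + a') * j b) = s k *: u (i a * j b) + u (i a' * j b).
Proof. by rewrite linearP semihom_mulPl. Qed.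

Definition product_form (u : semihom s C M) : linHom B (semihom s A M) :=
  mkform (product_form_linearl u) (product_form_semilinearr u).

Lemma product_form_linear : linear product_form.
Proof. by move=> k u v; apply: form_ext => b a. Qed.

Lemma semihom_mul_split (u : semihom s C M) x b b' a a' :
  u ((i a' + j b') * x * (i a * j b)) =
  u (x * (i a * j (b' * b))) + u (x * (i (a' * a) * j b)).
Proof.
rewrite !rmorphM -raddfD -mulrDr [(_ + _) * x]mulrC -[x * _ * _]mulrA.
rewrite mulrDl addrC.
by congr (u (x * (_ + _))); [exact: mulrCA | exact: mulrA].
Qed.

End ProductForms.

(* The transpose of the coproduct w |-> q w (x) 1 + 1 (x) p w. *)
Section LeibnizAction.
Variables (K : fieldType) (s : {rmorphism K -> K}) (W M : lmodType K).
Variables (A B : comAlgType K) (p : W -> A) (q : W -> B).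
Hypothesis p_linear : linear p.
Hypothesis q_semilinear : forall k v w, q (k *: v + w) = s k *: q v + q w.

Local Notation forms := (linHom B (semihom s A M)).

Definition leibniz_fun (w : W) (F : forms) (b : B) (a : A) : M :=
  F (q w * b) a + F b (p w * a).

Lemma leibniz_fun_linearl w F k b b' a :
  leibniz_fun w F (k *: b + b') a =
  k *: leibniz_fun w F b a + leibniz_fun w F b' a.
Proof.
rewrite /leibniz_fun mulrDr -scalerAr !form_linearPl scalerDr.
exact: addrACA.
Qed.

Lemma leibniz_fun_semilinearr w F k b a a' :
  leibniz_fun w F b (k *: a + a') =
  s k *: leibniz_fun w F b a + leibniz_fun w F b a'.
Proof.
rewrite /leibniz_fun mulrDr -scalerAr !form_semilinearPr scalerDr.
exact: addrACA.
Qed.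

Definition leibniz (w : W) (F : forms) : forms :=
  mkform (leibniz_fun_linearl w F) (leibniz_fun_semilinearr w F).

Lemma leibnizE w F b a : leibniz w F b a = F (q w * b) a + F b (p w * a).
Proof. by []. Qed.

Lemma leibniz_linear w : linear (leibniz w).
Proof.
move=> k F G; apply: form_ext => b a.
rewrite form_scaleDE !leibnizE !form_scaleDE scalerDr.
exact: addrACA.
Qed.

HB.instance Definition _ (w : W) :=
  GRing.isLinear.Build K forms forms *:%R (leibniz w) (leibniz_linear w).

Lemma leibnizC v w F : leibniz v (leibniz w F) = leibniz w (leibniz v F).
Proof.
apply: form_ext => b a; rewrite !leibnizE.
rewrite [q w * (q v * b)]mulrCA [p w * (p v * a)]mulrCA.
exact: addrACA.
Qed.

Lemma leibniz_semilinear k v w F :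
  leibniz (k *: v + w) F = s k *: leibniz v F + leibniz w F.
Proof.
apply: form_ext => b a.
rewrite form_scaleDE !leibnizE.
rewrite q_semilinear p_linear !mulrDl -!scalerAl.
rewrite form_linearPl form_semilinearPr scalerDr.
exact: addrACA.
Qed.

Definition form_act : symalg W -> forms -> forms := sym_act s leibniz.

Lemma form_act_genM w x F b a : form_act (sym_gen w * x) F b a =
  form_act x F (q w * b) a + form_act x F b (p w * a).
Proof. by rewrite /form_act (sym_act_genM leibnizC leibniz_semilinear). Qed.

Lemma form_act1 F : form_act 1 F = F.
Proof. exact: sym_act1 leibnizC leibniz_semilinear F. Qed.

Lemma form_actM x y F : form_act (x * y) F = form_act x (form_act y F).
Proof. exact: sym_actM leibnizC leibniz_semilinear x y F. Qed.

Lemma form_act_semilinear k x y F b a :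
  form_act (k *: x + y) F b a = s k *: form_act x F b a + form_act y F b a.
Proof.
by rewrite /form_act (sym_act_semilinear leibnizC leibniz_semilinear).
Qed.

Definition acts_by_mul (x : symalg W) (b : B) (a : A) : Prop :=
  forall F b' a', form_act x F b' a' = F (b * b') (a * a').

Lemma acts_by_mul1 : acts_by_mul 1 1 1.
Proof. by move=> F b a; rewrite form_act1 !mul1r. Qed.

Lemma acts_by_mulM x y b b' a a' : acts_by_mul x b a -> acts_by_mul y b' a' ->
  acts_by_mul (x * y) (b * b') (a * a').
Proof.
by move=> xba yba F c d; rewrite form_actM xba yba !mulrA [b' * b]mulrC
  [a' * a]mulrC.
Qed.

Lemma acts_by_mulPl k x y b b' a : acts_by_mul x b a -> acts_by_mul y b' a ->
  acts_by_mul (k *: x + y) (s k *: b + b') a.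
Proof.
move=> xba yba F c d.
by rewrite form_act_semilinear xba yba mulrDl -scalerAl form_linearPl.
Qed.

Lemma acts_by_mulPr k x y b a a' : acts_by_mul x b a -> acts_by_mul y b a' ->
  acts_by_mul (k *: x + y) b (k *: a + a').
Proof.
move=> xba yba F c d.
by rewrite form_act_semilinear xba yba mulrDl -scalerAl form_semilinearPr.
Qed.

Lemma acts_by_mul_genl w x b a : p w = 0 -> acts_by_mul x b a ->
  acts_by_mul (sym_gen w * x) (q w * b) a.
Proof.
move=> pw0 xba F c d; rewrite form_act_genM pw0 mul0r raddf0 addr0 xba.
by rewrite mulrCA mulrA.
Qed.

Lemma acts_by_mul_genr w x b a : q w = 0 -> acts_by_mul x b a ->
  acts_by_mul (sym_gen w * x) b (p w * a).
Proof.
move=> qw0 xba F c d; rewrite form_act_genM qw0 mul0r raddf0 add0r xba.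
by rewrite mulrCA mulrA.
Qed.

End LeibnizAction.

Lemma scaler_rect (K : comNzRingType) (U : lmodType K) (j r m : K) (x y : U) :
  j * j = -1 ->
  (r + j * m) *: (x + j *: y) = (r *: x - m *: y) + j *: (r *: y + m *: x).
Proof.
move=> jj; rewrite scalerDl !scalerDr !scalerA mulrAC jj mulN1r scaleNr.
by rewrite [r * j]mulrC [(j * m) *: x + _]addrC addrACA.
Qed.

Section ComplexConjugation.
Variables (R : realType) (E : lmodType R).

Definition cplx_conj (e : complexification E) : complexification E :=
  (e.1, - e.2).

Lemma cplx_conjK : involutive cplx_conj.
Proof. by case=> x y; rewrite /cplx_conj opprK. Qed.

Lemma cplx_conj_antilinear a e e' :
  cplx_conj (a *: e + e') = a^* *: cplx_conj e + cplx_conj e'.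
Proof.
case: a e e' => r m [x y] [x' y']; congr (_, _) => /=.
  by rewrite scalerN scaleNr opprK.
by rewrite scalerN scaleNr !opprD.
Qed.

Lemma cplx_conjZ a e : cplx_conj (a *: e) = a^* *: cplx_conj e.
Proof.
have conj0 : cplx_conj 0 = 0 by congr (_, _); exact: oppr0.
by rewrite -[a *: e]addr0 cplx_conj_antilinear conj0 addr0.
Qed.

End ComplexConjugation.

Section PlusMinusComponents.
Variables (R : realType) (V : lmodType R[i]).

Local Notation VC := (complexification (realification V)).
Local Notation invsqrt2 := ((sqrtC 2)^-1 : R[i]).

Definition plus_part (e : VC) : V := invsqrt2 *: ((e.1 : V) + 'i *: (e.2 : V)).

Definition minus_part (e : VC) : V := plus_part (cplx_conj e).

Lemma invsqrt2_conj : invsqrt2^* = invsqrt2.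
Proof. by rewrite geC0_conj // invr_ge0 sqrtC_ge0. Qed.

Lemma scale_invsqrt2_double (U : lmodType R[i]) (x : U) :
  invsqrt2 *: (invsqrt2 *: (x + x)) = x.
Proof.
rewrite scalerA -invfM -expr2 sqrtCK -mulr2n -[x *+ 2]scaler_nat scalerA.
by rewrite mulVf ?scale1r // pnatr_eq0.
Qed.

Lemma scale_iJ (v : V) : 'i *: (Jop v : V) = - v.
Proof. by rewrite /Jop scalerA -expr2 sqrCi scaleN1r. Qed.

Lemma cplx_conj_vec_plus (v : V) : cplx_conj (vec_plus v) = vec_minus v.
Proof.
by rewrite vec_plusE vec_minusE cplx_conjZ invsqrt2_conj /cplx_conj /= opprK.
Qed.

Lemma cplx_conj_vec_minus (v : V) : cplx_conj (vec_minus v) = vec_plus v.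
Proof. by rewrite -cplx_conj_vec_plus cplx_conjK. Qed.

Lemma plus_part_linear : linear plus_part.
Proof.
move=> a [x y] [x' y']; rewrite /plus_part /=.
rewrite scalerA [a * _]mulrC -scalerA -scalerDr; congr (_ *: _).
rewrite [in RHS](complexE a) complexiE (@scaler_rect _ V) -?expr2 ?sqrCi //.
by rewrite [X in _ + X = _]scalerDr addrACA.
Qed.

HB.instance Definition _ :=
  GRing.isLinear.Build R[i] VC V *:%R plus_part plus_part_linear.

Lemma minus_part_antilinear a e e' :
  minus_part (a *: e + e') = a^* *: minus_part e + minus_part e'.
Proof. by rewrite /minus_part cplx_conj_antilinear linearP. Qed.

Lemma vec_plusK : cancel (@vec_plus R V) plus_part.
Proof.
move=> v; rewrite vec_plusE linearZ /= /plus_part /=.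
by rewrite scalerN scale_iJ opprK scale_invsqrt2_double.
Qed.

Lemma plus_part_minus v : plus_part (vec_minus v) = 0.
Proof.
rewrite vec_minusE linearZ /= /plus_part /= scale_iJ.
by rewrite subrr !scaler0.
Qed.

Lemma vec_minusK : cancel (@vec_minus R V) minus_part.
Proof. by move=> v; rewrite /minus_part cplx_conj_vec_minus vec_plusK. Qed.

Lemma minus_part_plus v : minus_part (vec_plus v) = 0.
Proof. by rewrite /minus_part cplx_conj_vec_plus plus_part_minus. Qed.

Lemma plus_minus_decomposition e :
  vec_plus (plus_part e) + vec_minus (minus_part e) = e.
Proof.
have part_sum (x y : V) : x + 'i *: y + (x - 'i *: y) = x + x.
  by rewrite addrACA subrr addr0.
have Jpart_diff (x y : V) : Jop (x - 'i *: y) - Jop (x + 'i *: y) = y + y.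
  rewrite /Jop !scalerDr scalerN !scalerA -expr2 sqrCi !scaleN1r opprK opprB.
  by rewrite ['i *: x + y]addrC addrACA subrr addr0.
case: e => x y; rewrite /minus_part /plus_part !linearZ /= invsqrt2_conj.
rewrite vec_plusE vec_minusE -!scalerDr -[RHS](@scale_invsqrt2_double VC).
congr (_ *: (_ *: _)); congr (_, _) => /=.
  by rewrite scalerN part_sum.
by rewrite scalerN addrC Jpart_diff.
Qed.

End PlusMinusComponents.

Section OperatorSymbols.
Variables (R : realType) (V : lmodType R[i]).

Local Notation VC := (complexification (realification V)).
Local Notation operators := (linHom (symalg V) (antidual (symalg V))).

Definition plus_gen (w : VC) : symalg V := sym_gen (plus_part w).

Definition minus_gen (w : VC) : symalg V := sym_gen (minus_part w).

Lemma plus_gen_linear : linear plus_gen.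
Proof. by move=> a v w; rewrite /plus_gen !linearP. Qed.

Lemma minus_gen_antilinear a v w :
  minus_gen (a *: v + w) = a^* *: minus_gen v + minus_gen w.
Proof. by rewrite /minus_gen minus_part_antilinear linearP. Qed.

Definition op_act : symalg VC -> operators -> operators :=
  @form_act _ Num.conj _ (R[i])^o _ _ plus_gen minus_gen.

Lemma op_act1 F : op_act 1 F = F.
Proof. exact: form_act1 plus_gen_linear minus_gen_antilinear F. Qed.

Lemma op_act_semilinear a x y F phi psi :
  op_act (a *: x + y) F phi psi =
  a^* *: (op_act x F phi psi : (R[i])^o) + op_act y F phi psi.
Proof. exact: (form_act_semilinear plus_gen_linear minus_gen_antilinear). Qed.

Lemma op_act_genM w x F phi psi : op_act (sym_gen w * x) F phi psi =
  op_act x F (minus_gen w * phi) psi + op_act x F phi (plus_gen w * psi).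
Proof. exact: (form_act_genM plus_gen_linear minus_gen_antilinear). Qed.

Lemma sym_plus_genM (v : V) x :
  sym_plus (sym_gen v * x) = sym_gen (vec_plus v) * sym_plus x.
Proof.
apply: etrans (rmorphM (@sym_plus R V) (sym_gen v) x) _.
exact: (congr1 (fun y => y * sym_plus x) (sym_plus_gen v)).
Qed.

Lemma sym_minus_genM (v : V) x :
  sym_minus (sym_gen v * x) = sym_gen (vec_minus v) * sym_minus x.
Proof.
apply: etrans (rmorphM (@sym_minus R V) (sym_gen v) x) _.
exact: (congr1 (fun y => y * sym_minus x) (sym_minus_gen v)).
Qed.

Lemma minus_gen_plus v : minus_gen (vec_plus v) = 0.
Proof. by rewrite /minus_gen minus_part_plus linear0. Qed.

Lemma plus_gen_minus v : plus_gen (vec_minus v) = 0.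
Proof. by rewrite /plus_gen plus_part_minus linear0. Qed.

Lemma plus_gen_plus v : plus_gen (vec_plus v) = sym_gen v.
Proof. by rewrite /plus_gen vec_plusK. Qed.

Lemma minus_gen_minus v : minus_gen (vec_minus v) = sym_gen v.
Proof. by rewrite /minus_gen vec_minusK. Qed.

Local Notation op_acts_by_mul :=
  (@acts_by_mul _ Num.conj _ (R[i])^o _ _ plus_gen minus_gen).

Lemma sym_plus_acts_by_mul psi : op_acts_by_mul (sym_plus psi) 1 psi.
Proof.
elim/sym_ind: psi => [|a x y IHx IHy|v x IH].
- rewrite (rmorph1 (@sym_plus R V)).
  exact: (acts_by_mul1 plus_gen_linear minus_gen_antilinear).
- rewrite [sym_plus _]linearP.
  exact: (acts_by_mulPr plus_gen_linear minus_gen_antilinear).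
rewrite sym_plus_genM -plus_gen_plus.
apply: (acts_by_mul_genr plus_gen_linear minus_gen_antilinear) => //.
exact: minus_gen_plus.
Qed.

Lemma sym_minus_acts_by_mul phi : op_acts_by_mul (sym_minus phi) phi 1.
Proof.
elim/sym_ind: phi => [|a x y IHx IHy|v x IH].
- rewrite (rmorph1 (@sym_minus R V)).
  exact: (acts_by_mul1 plus_gen_linear minus_gen_antilinear).
- rewrite [sym_minus _]linearP -[a in a *: x]conjCK.
  exact: (acts_by_mulPl plus_gen_linear minus_gen_antilinear).
rewrite sym_minus_genM -minus_gen_minus.
apply: (acts_by_mul_genl plus_gen_linear minus_gen_antilinear) => //.
exact: plus_gen_minus.
Qed.

Lemma sym_gen_split (w : VC) :
  sym_plus (plus_gen w) + sym_minus (minus_gen w) = sym_gen w.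
Proof.
rewrite sym_plus_gen sym_minus_gen -(raddfD (@sym_gen _ VC)).
exact: congr1 (plus_minus_decomposition w).
Qed.

Definition operator_of (u : antidual (symalg VC)) : operators :=
  product_form (@sym_plus R V) conjCK (@sym_minusZ R V) u.

Lemma operator_of_linear : linear operator_of.
Proof. exact: product_form_linear. Qed.

HB.instance Definition _ := GRing.isLinear.Build R[i]
  (antidual (symalg VC)) operators *:%R operator_of operator_of_linear.

Lemma operator_ofE u phi psi :
  operator_of u phi psi = u (sym_plus psi * sym_minus phi).
Proof. by []. Qed.

Lemma op_act_operator_of x u phi psi :
  op_act x (operator_of u) phi psi = u (x * (sym_plus psi * sym_minus phi)).
Proof.
elim/sym_ind: x phi psi => [|a x y IHx IHy|w x IH] phi psi.
- by rewrite op_act1 mul1r.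
- rewrite op_act_semilinear [RHS]semihom_mulPl.
  by congr (_ *: _ + _); [exact: IHx | exact: IHy].
rewrite op_act_genM -[in RHS]sym_gen_split [RHS]semihom_mul_split.
congr (_ + _); exact: IH.
Qed.

Definition symbol_fun (F : operators) (x : symalg VC) : (R[i])^o :=
  op_act x F 1 1.

Lemma symbol_fun_antilinear F :
  symbol_fun F \in @semilinear_fun _ Num.conj (symalg VC) (R[i])^o.
Proof. by apply/asboolP => a x y; exact: op_act_semilinear. Qed.

Definition symbol_of (F : operators) : antidual (symalg VC) :=
  Semihom (symbol_fun_antilinear F).

Lemma symbol_ofE F x : symbol_of F x = op_act x F 1 1.
Proof. by []. Qed.

Lemma operator_ofK : cancel operator_of symbol_of.
Proof.
move=> u; apply/val_inj/funext => x.
apply: etrans (op_act_operator_of _ _ _ _) _; congr (u _).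
by rewrite (rmorph1 (@sym_plus R V)) (rmorph1 (@sym_minus R V)) !mulr1.
Qed.

Lemma symbol_ofK : cancel symbol_of operator_of.
Proof.
move=> F; apply: form_ext => phi psi; rewrite operator_ofE symbol_ofE.
rewrite [LHS](acts_by_mulM plus_gen_linear minus_gen_antilinear
  (sym_plus_acts_by_mul psi) (sym_minus_acts_by_mul phi)).
by congr (F _ _); rewrite ?mul1r !mulr1.
Qed.

End OperatorSymbols.

Theorem theorem1 (R : realType) (V : complexHilbertType R) :
  exists T : {linear antidual (symalg (complexification (realification V))) ->
                     linHom (symalg V) (antidual (symalg V))},
    bijective T /\
    forall (u : antidual (symalg (complexification (realification V))))
           (phi psi : symalg V),
      T u phi psi = u (sym_plus psi * sym_minus phi).
Proof.
exists (@operator_of R V); split=> //.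
by exists (@symbol_of R V); [exact: operator_ofK | exact: symbol_ofK].
Qed.
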